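(* Let $K$ be a field and let $A=K\langle X\rangle/(w_1,\dots,w_t)$ be a non-unital monomial associative algebra, where no $w_i$ is a subword of another $w_j$ and no $w_i$ is an element of $X$. Let $w=x_1\cdots x_n$ be a word in the letters of $X$, let $$0\xrightarrow{D_{n+1}}B_n\xrightarrow{D_n}B_{n-1}\xrightarrow{D_{n-1}}\cdots\xrightarrow{D_2}B_1\xrightarrow{D_1}0$$ be the subcomplex $B_w$ of the bar complex of $A$ associated with $w$, and suppose that this complex is not exact. Let $r$ be the length of the generalised Dyck path of $w$. For $i=1,\dots,n$ put $$H_i=\ker D_{n-i+1}/\operatorname{im}D_{n-i+2}.$$ Then $$\dim_K H_{n-r}=1,\qquad H_i=0\quad\text{for all } i\in\{1,\dots,n\},\ i\neq n-r.$$
   Context: $K\langle X\rangle$ is the free associative algebra without unit on the set $X$ (with basis the nonempty words in $X$), and $A$ is its quotient by the two-sided ideal generated by the words $w_1,\dots,w_t$. A basis of $A$ is given by the nonempty words containing no $w_i$ as a subword (contiguous factor); all other words are zero in $A$. For a word $w=x_1\cdots x_n$, $B_k\subset A^{\otimes k}$ is the $K$-span of the tensors $u_1\otimes\cdots\otimes u_k$ such that $u_1,\dots,u_k$ are nonempty words whose concatenation is $w$ and each $u_j$ is nonzero in $A$. The differential is $$D_k(u_1\otimes\cdots\otimes u_k)=\sum_{i=1}^{k-1}(-1)^{i-1}u_1\otimes\cdots\otimes u_iu_{i+1}\otimes\cdots\otimes u_k,$$ with the product $u_iu_{i+1}$ taken in $A$. Generalised Dyck path of $w=x_1\cdots x_n$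 (with respect to $w_1,\dots,w_t$): let $d_1$ be the smallest index such that $x_1\cdots x_{d_1}$ is zero in $A$; let $d_2$ be the smallest index such that $x_2\cdots x_{d_2}$ is zero in $A$; let $d_3$ be the smallest index such that $x_{d_1+1}\cdots x_{d_3}$ is zero in $A$; let $d_4$ be the smallest index such that $x_{d_2+1}\cdots x_{d_4}$ is zero in $A$; and in general, for $j\ge 3$, let $d_j$ be the smallest index such that $x_{d_{j-2}+1}\cdots x_{d_j}$ is zero in $A$. The procedure stops as soon as no such index exists. The resulting (possibly empty) sequence $d_1\le d_2\le\cdots\le d_p$ is the generalised Dyck path, and its length $r$ is the number of different numbers in this sequence. *)

(* Defs.v *)
From HB Require Import structures.
From mathcomp Require Import all_boot all_order all_algebra.
Set Implicit Arguments.
Unset Strict Implicit.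
Unset Printing Implicit Defensive.
Import GRing.Theory.
Local Open Scope ring_scope.

(* The monomial algebra A = K<X>/(w_1, ..., w_t) is handled through its       *)
(* standard basis: the nonempty words with no contiguous factor among the w_i;*)
(* every other nonempty word is zero in A.                                    *)
Section Words.
Variables (X : choiceType) (t : nat) (ws : t.-tuple (seq X)).

Definition is_zero (u : seq X) : bool := has (fun v => infix v u) ws.

Definition basis_word (u : seq X) : bool := (u != [::]) && ~~ is_zero u.

(* mult_at i [:: u_0; ...; u_m] = [:: u_0; ...; u_i ++ u_(i+1); ...; u_m],    *)
(* for i < m.                                                                 *)
Fixpoint mult_at (i : nat) (u : seq (seq X)) : seq (seq X) :=
  match i, u with
  | 0, a :: b :: s => (a ++ b) :: s
  | i'.+1, a :: s => a :: mult_at i' s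
  | _, _ => u
  end.

Lemma size_mult_at i u : (i.+1 < size u)%N -> size (mult_at i u) = (size u).-1.
Proof.
elim: i u => [|i IHi] [|a [|b s]] // i_s.
by rewrite [LHS](congr1 S (IHi (b :: s) i_s)).
Qed.

Lemma mult_atA i j u : (i <= j)%N ->
  mult_at j (mult_at i u) = mult_at i (mult_at j.+1 u).
Proof.
elim: i j u => [|i IHi] j u; last first.
  by case: j u => // j [|a s] // /IHi le_ij /=; rewrite le_ij.
case: u => [|a [|b s]] _; [by case: j | by case: j => // -[] |].
by case: j => [|j] //; case: s => [|c s] //=; rewrite catA.
Qed.

Lemma flatten_mult_at i u : flatten (mult_at i u) = flatten u.
Proof.
elim: i u => [|i IHi] [|a s] //=; last by rewrite IHi.
by case: s => //= b s; rewrite catA.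
Qed.

Lemma all_mult_at i u : all (fun v => v != [::]) u ->
  all (fun v => v != [::]) (mult_at i u).
Proof.
elim: i u => [|i IHi] [|a s] //=; last by move=> /andP[-> /IHi].
by case: s => //= b s /and3P[a_n0 _ ->]; rewrite andbT; case: a a_n0.
Qed.

Lemma basis_word_catl u v : u != [::] -> basis_word (u ++ v) -> basis_word u.
Proof.
rewrite /basis_word => -> /andP[_]; apply: contra => /hasP[x x_ws x_u].
by apply/hasP; exists x => //; rewrite infix_catr.
Qed.

Lemma basis_word_catr u v : v != [::] -> basis_word (u ++ v) -> basis_word v.
Proof.
rewrite /basis_word => -> /andP[_]; apply: contra => /hasP[x x_ws x_u].
by apply/hasP; exists x => //; rewrite infix_catl.
Qed.

Lemma all_basis_word_mult_at i u : all (fun v => v != [::]) u ->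
  all basis_word (mult_at i u) -> all basis_word u.
Proof.
elim: i u => [|i IHi] [|a s] //=; last first.
  by move=> /andP[_ s_n0] /andP[-> /IHi ->].
case: s => //= b s /and3P[a_n0 b_n0 _] /andP[ab ->].
by rewrite (basis_word_catl a_n0 ab) (basis_word_catr b_n0 ab).
Qed.

Variable w : seq X.

(* Basis of B_k: the k-fold tensors u_1 (x) ... (x) u_k of basis words of A   *)
(* with concatenation w. Being tensors of elements of a basis of A, they are  *)
(* linearly independent in the k-th tensor power of A.                        *)
Record bar_basis (k : nat) := BarBasis {
  bar_val :> k.-tuple (seq X);
  _ : (flatten bar_val == w) && all basis_word bar_val }.

HB.instance Definition _ k := [isSub for @bar_val k].
HB.instance Definition _ k := [Choice of bar_basis k by <:].

Definition bar_shape k (u : bar_basis k) : k.-tuple 'I_(size w).+1 :=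
  map_tuple (fun v => inord (size v)) u.

Definition bar_unshape k (s : k.-tuple 'I_(size w).+1) :
    option (bar_basis k) :=
  obind insub (insub (reshape (map val s) w) : option (k.-tuple (seq X))).

Lemma bar_shapeK k : pcancel (@bar_shape k) (@bar_unshape k).
Proof.
case=> u /= Pu; rewrite /bar_unshape /bar_shape /=.
case/andP: (Pu) => /eqP uw _.
have -> : reshape [seq \val i | i <- [seq @inord (size w) (size v) | v <- u]] w = u
    :> seq (seq X).
  rewrite -[X in reshape _ X]uw -map_comp -[RHS](flattenK u); congr reshape.
  apply/eq_in_map => v v_u /=; rewrite inordK // ltnS -uw size_flatten sumnE.
  by rewrite big_map (perm_big _ (perm_to_rem v_u)) big_cons leq_addr.
by rewrite valK /= insubT.
Qed.

HB.instance Definition _ k : isCountable (bar_basis k) :=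
  PCanIsCountable (@bar_shapeK k).
HB.instance Definition _ k : isFinite (bar_basis k) :=
  PCanIsFinite (@bar_shapeK k).

(* The smallest e such that x_(a+1) ... x_e is zero in A, if there is one.    *)
Definition next_zero (a : nat) : option nat :=
  ohead [seq e <- iota a.+1 (size w - a) | is_zero (drop a (take e w))].

Fixpoint dyck_from (fuel a b : nat) : seq nat :=
  if fuel isn't m.+1 then [::] else
  if next_zero a is Some d then d :: dyck_from m b d else [::].

(* With d_(-1) = 0 and d_0 = 1, each d_j is the next zero after d_(j-2). As   *)
(* d_j > d_(j-2) and d_j <= n, the 2n steps allowed here never cut the path   *)
(* short.                                                                     *)
Definition dyck_path : seq nat := dyck_from (2 * size w) 0 1.

Definition dyck_length : nat := size (undup dyck_path).

End Words.

Section BarComplex.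
Variables (K : fieldType) (X : choiceType) (t : nat) (ws : t.-tuple (seq X)).
Variable w : seq X.

Definition bar (k : nat) : vectType K := {ffun bar_basis ws w k -> K^o}.

(* u_1 (x) ... (x) u_k as an element of B_k; it is 0 as soon as some u_j is   *)
(* zero in A, since u is then no element of bar_basis.                        *)
Definition tensor (k : nat) (u : seq (seq X)) : bar k :=
  [ffun v : bar_basis ws w k => (tval v == u)%:R : K^o].

(* With summation index i counted from 0, the sign (-1)^(i-1) becomes (-1)^i. *)
Definition bar_diff_fun (k : nat) (f : bar k) : bar k.-1 :=
  \sum_(u : bar_basis ws w k)
     f u *: \sum_(i < k.-1) (-1) ^+ i *: tensor k.-1 (mult_at i u).

Lemma bar_diff_fun_linear k : linear (@bar_diff_fun k).
Proof.
move=> a f g; rewrite /bar_diff_fun scaler_sumr -big_split /=.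
by apply: eq_bigr => u _; rewrite !ffunE scalerDl scalerA.
Qed.

HB.instance Definition _ k :=
  GRing.isLinear.Build K (bar k) (bar k.-1) _ _ (@bar_diff_fun_linear k).

Definition bar_diff (k : nat) : 'Hom(bar k, bar k.-1) :=
  linfun (@bar_diff_fun k).

Definition bar_ker (k : nat) : {vspace bar k} := lker (bar_diff k).

Definition bar_im (k : nat) : {vspace bar k} := limg (bar_diff k.+1).

(* Exactness of 0 -> B_n -> ... -> B_1 -> 0 for n = size w, w nonempty; in    *)
(* that case B_(n+1) = B_0 = 0.                                               *)
Definition bar_exact : Prop :=
  forall k : nat, (1 <= k <= size w)%N -> bar_ker k = bar_im k.

(* H_i = ker D_(n-i+1) / im D_(n-i+2), realised as a complement of the image  *)
(* in the kernel; see bar_im_sub_ker.                                         *)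
Definition bar_homology (i : nat) : {vspace bar (size w - i).+1} :=
  (bar_ker (size w - i).+1 :\: bar_im (size w - i).+1)%VS.

Lemma bar_diff_tensor k (u : seq (seq X)) :
    size u = k -> all (fun v => v != [::]) u ->
  bar_diff k (tensor k u) =
    \sum_(i < k.-1) (-1) ^+ i *: tensor k.-1 (mult_at i u).
Proof.
move=> uk u_n0; rewrite lfunE /= /bar_diff_fun.
have [uP|uNP] := boolP ((flatten u == w) && all (basis_word ws) u).
  pose v : bar_basis ws w k := @BarBasis _ _ ws w k (Tuple (introT eqP uk)) uP.
  rewrite (bigD1 v) //= [X in _ + X]big1 => [|v' v'v].
    by rewrite ffunE eqxx scale1r addr0.
  rewrite ffunE; case: eqP => [v'u|_]; last by rewrite scale0r.
  by case/eqP: v'v; do 2!apply: val_inj.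
rewrite big1 => [|v _]; last first.
  rewrite ffunE; case: eqP => [vu|_]; last by rewrite scale0r.
  by case/negP: uNP; rewrite -vu; case: v {vu}.
rewrite big1 // => i _; apply/ffunP => v; rewrite !ffunE.
case: eqP => [vu|_]; last by rewrite scaler0.
case/negP: uNP; case: v vu => v /= /andP[/eqP vw v_b] vu.
rewrite -(flatten_mult_at i) -vu vw eqxx /=.
by apply: (all_basis_word_mult_at (i := i)) => //; rewrite -vu.
Qed.

Lemma sum_simplicial (V : lmodType K) n (F : nat -> nat -> V) :
    (forall i j, (i <= j)%N -> F i j = F j.+1 i) ->
  \sum_(i < n.+1) \sum_(j < n) (-1) ^+ i *: ((-1) ^+ j *: F i j) = 0.
Proof.
move=> FE; rewrite exchange_big /=.
under eq_bigr => j _ do rewrite (bigID (fun i : 'I__ => (i <= j)%N)) /=.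
rewrite big_split /= [X in X + _](_ : _ =
    \sum_(j < n) \sum_(i < n | (i <= j)%N) (-1) ^+ i *: ((-1) ^+ j *: F i j)).
  rewrite [X in _ + X](_ : _ = - \sum_(j < n) \sum_(i < n | (j <= i)%N)
      (-1) ^+ j *: ((-1) ^+ i *: F j i)); last first.
    rewrite -sumrN; apply: eq_bigr => j _; rewrite big_mkcond big_ord_recl /=.
    rewrite add0r -sumrN [RHS]big_mkcond; apply: eq_bigr => i _ /=.
    rewrite -ltnNge ltnS; case: leqP => // le_ji.
    by rewrite (FE _ _ le_ji) exprS !scalerA mulN1r mulrC mulrN scaleNr mulrC.
  rewrite (exchange_big_dep xpredT) //= subrr //.
apply: eq_bigr => j _; rewrite big_mkcond big_ord_recr /= leqNgt ltn_ord addr0.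
by rewrite [RHS]big_mkcond.
Qed.

Lemma bar_diff_comp k : (bar_diff k.-1 \o bar_diff k)%VF = 0.
Proof.
apply/lfunP => f; rewrite comp_lfunE zero_lfunE [bar_diff k f]lfunE /=.
rewrite /bar_diff_fun linear_sum big1 //= => u _.
rewrite linearZ /= linear_sum /=.
suff -> : \sum_(i < k.-1)
    bar_diff k.-1 ((-1) ^+ i *: tensor k.-1 (mult_at i u)) = 0.
  by rewrite scaler0.
have sk := size_tuple u.
have s_n0 : all (fun v => v != [::]) u.
  by case: u {sk} => u /= /andP[_]; apply: sub_all => v /andP[].
move: (tval u) sk s_n0 => s {u f}.
case: k => [|[|m]] sk s_n0; rewrite ?big_ord0 //=.
pose F i j := tensor m (mult_at j (mult_at i s)).
apply: etrans (@sum_simplicial _ m F _) => [|i j le_ij]; last first.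
  by rewrite /F mult_atA.
apply: eq_bigr => i _; rewrite linearZ /= -scaler_sumr; congr (_ *: _).
rewrite bar_diff_tensor ?all_mult_at //.
by rewrite size_mult_at sk // !ltnS -ltnS ltn_ord.
Qed.

Lemma bar_im_sub_ker k : (bar_im k <= bar_ker k)%VS.
Proof.
apply/subvP => x x_im; have [f _ ->] := memv_imgP x_im; rewrite memv_ker.
by rewrite -[_ (_ f)]comp_lfunE (bar_diff_comp k.+1) zero_lfunE.
Qed.

End BarComplex.

(* Main.v *)
Require Import Defs.
From HB Require Import structures.
From mathcomp Require Import all_boot all_order all_algebra.
Set Implicit Arguments.
Unset Strict Implicit.
Unset Printing Implicit Defensive.
Import GRing.Theory.
Local Open Scope ring_scope.

(** Let a < b be positions in w and let p be a list of words whose            *)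
(*  concatenation is x_1 ... x_a. Consider the chains on those tensors that   *)
(*  begin with p, followed by a block ending at or after b. If d is the next  *)
(*  zero after a and d > b, match the tensors p, x_(a+1)...x_c, ... with      *)
(*  b < c < d with p, x_(a+1)...x_b, x_(b+1)...x_c, ... ; the unmatched       *)
(*  tensors span a subcomplex of the same shape, for the list                 *)
(*  p, x_(a+1)...x_b and the pair (b, d), and the quotient is acyclic.        *)
(*  Starting from the pair (0, 1), the pairs so obtained are the consecutive  *)
(*  entries of the Dyck path. The process ends when d <= b, where there are   *)
(*  no chains at all, or when there is no next zero: then the matching is     *)
(*  perfect if b < n, and if b = n there is at most one tensor. Hence a       *)
(*  nonexact complex has a strictly increasing path, and its homology is      *)
(*  spanned by a single tensor with r + 1 factors.                            *)

(** In terms of discrete Morse theory, [rigid p b] is the invariant: any merge that would alter [p]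
    gives zero, so the tensors in [level p b] span a subcomplex ([supported_diff]). Passing to the
    next pair appends one factor to [p]. The quotient is acyclic by [level_retract], and the
    invariant survives by [rigid_rcons], because absorbing the next block into the new factor would
    create the zero word ending at [d]. [acyclic_retract] and [line_homology_retract] carry the
    homology back, [level_last] settles the case b = n, and [dyck_homology] is the induction. Each
    entry of the path contributes one factor and the end of the word one more, so the surviving
    tensor has degree r + 1, which is the degree of H_(n-r). *)

Lemma mult_at_cat (X : choiceType) i (p s : seq (seq X)) :
  mult_at (size p + i) (p ++ s) = p ++ mult_at i s.
Proof. by elim: p => //= a p ->. Qed.

Lemma take_drop_catl (T : Type) (s u v : seq T) a :
  drop a s = u ++ v -> u = drop a (take (a + size u) s).
Proof. by move=> s_uv; rewrite addnC -take_drop s_uv take_size_cat. Qed.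

Section DyckFiltration.
Variables (X : choiceType) (t : nat) (ws : t.-tuple (seq X)) (w : seq X).
Implicit Types (p u : seq (seq X)) (a b d : nat).

Notation subword a b := (drop a (take b w)).

(** * Zero factors of the word and the next zero *)

Lemma is_zero_cat (u v : seq X) : is_zero ws u -> is_zero ws (u ++ v).
Proof.
by case/hasP=> x x_ws x_u; apply/hasP; exists x => //; apply: infix_catr.
Qed.

Lemma is_zero_subword a b d : (b <= d)%N ->
  is_zero ws (subword a b) -> is_zero ws (subword a d).
Proof.
move=> le_bd; rewrite -[take d w](cat_take_drop b) take_takel // drop_cat.
case: ltnP => [_|/drop_oversize->]; first exact: is_zero_cat.
exact: (@is_zero_cat [::]).
Qed.

Variant next_zero_spec a : option nat -> Type :=
| NextZeroSome d of (a < d <= size w)%N & is_zero ws (subword a d)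
    & (forall c, (a < c < d)%N -> ~~ is_zero ws (subword a c)) :
    next_zero_spec a (Some d)
| NextZeroNone of
    (forall c, (a < c <= size w)%N -> ~~ is_zero ws (subword a c)) :
    next_zero_spec a None.

Lemma next_zeroP a : next_zero_spec a (next_zero ws w a).
Proof.
rewrite /next_zero.
set P := fun e => _.
have mem_iota_w c : (c \in iota a.+1 (size w - a)) = (a < c <= size w)%N.
  rewrite mem_iota; have [lt_ac|//] := ltnP a c; rewrite /= addSn ltnS.
  have [le_aw|lt_wa] := leqP a (size w); first by rewrite subnKC.
  have -> : (size w - a = 0)%N by apply/eqP; rewrite subn_eq0 ltnW.
  by rewrite addn0 leqNgt lt_ac leqNgt (ltn_trans lt_wa lt_ac).
(* Sortedness makes the head of the filtered list its minimum. *)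
have : sorted ltn [seq e <- iota a.+1 (size w - a) | P e].
  by apply: sorted_filter; [apply: ltn_trans | apply: iota_ltn_sorted].
have mem_s c : (c \in [seq e <- iota a.+1 (size w - a) | P e]) =
    (P c) && (a < c <= size w)%N by rewrite mem_filter mem_iota_w.
case: [seq e <- _ | _] mem_s => [|d s] mem_s /= d_s; constructor.
- by move=> c c_w; apply/negP => Pc; have := mem_s c; rewrite c_w [P c]Pc.
- by have := mem_s d; rewrite inE eqxx => /esym/andP[].
- by have := mem_s d; rewrite inE eqxx => /esym/andP[].
move=> c /andP[lt_ac lt_cd]; apply/negP => Pc.
have := mem_s d; rewrite inE eqxx => /esym/andP[_ /andP[_ le_dw]].
have := mem_s c; rewrite lt_ac (leq_trans (ltnW lt_cd) le_dw) [P c]Pc inE.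
case/predU1P=> [c_d|c_s]; first by rewrite c_d ltnn in lt_cd.
have /allP/(_ _ c_s) := order_path_min ltn_trans d_s.
by rewrite /= ltnNge ltnW.
Qed.

(** * The sets of tensors attached to a pair of positions *)

Definition level p b : pred (seq (seq X)) :=
  [pred u | (take (size p) u == p)
          & (b <= size (flatten (take (size p).+1 u)))%N].

Lemma levelP p b u : (size (flatten p) < b)%N ->
  reflect (exists v s, u = p ++ v :: s /\ (b <= size (flatten p) + size v)%N)
          (level p b u).
Proof.
move=> lt_pb; apply: (iffP andP) => [[/eqP u_p]|[v [s [-> le_b]]]]; last first.
  rewrite take_size_cat // -cat_rcons take_size_cat ?size_rcons // eqxx.
  by rewrite flatten_rcons size_cat.
rewrite -[u in X in X -> _](cat_take_drop (size p)) u_p.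
rewrite -[u in X in _ -> X](cat_take_drop (size p)) u_p.
case: (drop _ _) => [|v s].
  by rewrite cats0 take_oversize // leqNgt lt_pb.
rewrite -cat_rcons take_size_cat ?size_rcons // flatten_rcons size_cat => le_b.
by exists v, s; rewrite cat_rcons.
Qed.

Definition bar_word u := (flatten u == w) && all (basis_word ws) u.

Lemma bar_basisP k (u : bar_basis ws w k) : bar_word u.
Proof. by case: u. Qed.

(* No two adjacent blocks among the first [size p].+1 can be merged without  *)
(* giving zero, so that [level p b] spans a subcomplex.                      *)
Definition rigid p b := forall u i, level p b u -> flatten u = w ->
  (i < size p)%N -> ~~ all (basis_word ws) (mult_at i u).

Lemma bar_word_cat p v s : flatten p = take (size (flatten p)) w ->
    bar_word (p ++ v :: s) ->
  [/\ v = subword (size (flatten p)) (size (flatten p) + size v),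
      drop (size (flatten p)) w = v ++ flatten s,
      all (basis_word ws) p, basis_word ws v & all (basis_word ws) s].
Proof.
move=> p_w /andP[/eqP u_w]; rewrite all_cat /= => /and3P[-> -> ->].
have w_v : drop (size (flatten p)) w = v ++ flatten s.
  by rewrite -u_w flatten_cat drop_size_cat.
by split=> //; apply: take_drop_catl w_v.
Qed.

Lemma bar_word_basis k u : bar_word u -> size u = k ->
  exists v : bar_basis ws w k, tval v = u.
Proof.
by move=> u_w /eqP u_k; exists (@BarBasis _ _ ws w k (Tuple u_k) u_w).
Qed.

Lemma size_subword a b : (a <= b <= size w)%N ->
  (a + size (subword a b))%N = b.
Proof. by move=> /andP[le_ab le_bw]; rewrite size_drop size_takel ?subnKC. Qed.

Lemma level_block p b (v : seq X) s : (size (flatten p) <= b <= size w)%N ->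
    flatten p = take (size (flatten p)) w -> bar_word (p ++ v :: s) ->
    (b <= size (flatten p) + size v)%N ->
  exists v', v = subword (size (flatten p)) b ++ v'.
Proof.
move=> /andP[le_pb le_bw] p_w u_w le_bv.
have [_ w_v _ _ _] := bar_word_cat p_w u_w.
exists (drop (b - size (flatten p)) v).
rewrite -[in subword _ _](subnK le_pb) -take_drop w_v take_cat.
case: ltnP => [_|le_v]; first by rewrite cat_take_drop.
have -> : (b - size (flatten p) = size v)%N.
  by apply/eqP; rewrite eqn_leq le_v leq_subLR le_bv.
by rewrite subnn take0 cats0 drop_size cats0.
Qed.

Lemma level_mult_at p b j (v : seq X) s : (size (flatten p) < b)%N ->
  (b <= size (flatten p) + size v)%N -> level p b (p ++ mult_at j (v :: s)).
Proof.
move=> lt_pb le_bv; apply/levelP => //.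
case: j s => [|j] [|v1 s] /=; do ?by exists v; eexists.
exists (v ++ v1), s; split=> //.
by rewrite size_cat addnA (leq_trans le_bv) ?leq_addr.
Qed.

(** * Chains supported on a level, and the matching *)

Variable K : fieldType.
Local Notation bar := (bar K ws w).
Local Notation D := (bar_diff K ws w).

Lemma bar_diffK k (f : bar k.+1) : D k (D k.+1 f) = 0.
Proof.
by rewrite -[D k _]comp_lfunE (bar_diff_comp K ws w k.+1) zero_lfunE.
Qed.

Definition supported (P : pred (seq (seq X))) k (f : bar k) :=
  forall u : bar_basis ws w k, f u != 0 -> P u.

Lemma bar_diffE k (x : bar k) (m : bar_basis ws w k.-1) :
  D k x m = \sum_(u : bar_basis ws w k)
    x u * \sum_(i < k.-1) (-1) ^+ i * (tval m == mult_at i u)%:R.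
Proof.
rewrite lfunE /= /bar_diff_fun sum_ffunE; apply: eq_bigr => u _.
rewrite ffunE sum_ffunE; congr (_ * _); apply: eq_bigr => i _.
by rewrite !ffunE.
Qed.

Lemma rigid_merge_ge p b k (u : bar_basis ws w k) (m : bar_basis ws w k.-1) i :
  rigid p b -> level p b u -> tval m = mult_at i u :> seq _ -> (size p <= i)%N.
Proof.
move=> p_rigid u_p m_u; rewrite leqNgt; apply/negP => lt_ip.
have /andP[/eqP u_w _] := bar_basisP u.
have /andP[_ m_basis] := bar_basisP m.
by have := p_rigid _ _ u_p u_w lt_ip; rewrite -m_u m_basis.
Qed.

(** Merges at an index below [size p] vanish by rigidity; the others keep [p] and can only lengthen
    the block after it. *)
Lemma supported_diff p b k (x : bar k) : (size (flatten p) < b)%N ->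
  rigid p b -> supported (level p b) x -> supported (level p b) (D k x).
Proof.
move=> lt_pb p_rigid x_p m; apply: contraR => m_p; rewrite bar_diffE.
apply/eqP/big1 => u _.
have [->|/x_p u_p] := eqVneq (x u) 0; first by rewrite mul0r.
rewrite big1 ?mulr0 // => i _; case: eqP => [m_u|]; last by rewrite mulr0.
have le_pi := rigid_merge_ge p_rigid u_p m_u.
case/negP: m_p; rewrite m_u; have /(levelP _ lt_pb)[v [s [-> le_bv]]] := u_p.
by rewrite -(subnKC le_pi) mult_at_cat level_mult_at.
Qed.

Definition starts p (v : seq X) : pred (seq (seq X)) :=
  [pred u | take (size p).+1 u == rcons p v].

Lemma startsP p (v : seq X) u :
  reflect (exists s, u = p ++ v :: s) (starts p v u).
Proof.
apply: (iffP eqP) => [u_p|[s ->]].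
  by exists (drop (size p).+1 u); rewrite -cat_rcons -u_p cat_take_drop.
by rewrite -cat_rcons take_size_cat ?size_rcons.
Qed.

(** Only the merge at index [size p] turns the block [v] into a longer one: earlier merges vanish by
    rigidity and later ones leave [v] intact. So a single term of the differential contributes. *)
Lemma bar_diff_merge p b k (x : bar k) (m : bar_basis ws w k.-1)
    (u : bar_basis ws w k) (v v' : seq X) s :
    (size (flatten p) < b <= size (flatten p) + size v)%N -> rigid p b ->
    supported (starts p v) x ->
    tval u = p ++ v :: v' :: s :> seq (seq X) ->
    tval m = p ++ (v ++ v') :: s :> seq (seq X) ->
  D k x m = (-1) ^+ size p * x u.
Proof.
move=> /andP[lt_pb le_bv] p_rigid x_v u_s m_s; rewrite bar_diffE.
have v'_n0 : v' != [::].
  have /andP[_] := bar_basisP u.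
  by rewrite u_s all_cat /= => /and4P[_ _ /andP[]].
have size_u : size (tval u) = k by rewrite size_tuple.
have lt_pk : (size p < k.-1)%N.
  by rewrite -size_u u_s size_cat /= !addnS ltnS leq_addr.
have level_v u1 s1 : u1 = p ++ v :: s1 -> level p b u1.
  by move=> ->; apply/levelP => //; exists v, s1.
rewrite (bigD1 u) //= [X in _ + X]big1 ?addr0 => [|u' u'_u].
  rewrite mulrC; congr (_ * _).
  rewrite (bigD1 (Ordinal lt_pk)) //= [X in _ + X]big1 ?addr0 => [|i ip].
    by rewrite u_s -[size p]addn0 mult_at_cat /= m_s eqxx mulr1.
  case: eqP => [m_u|]; last by rewrite mulr0.
  have le_pi := rigid_merge_ge p_rigid (level_v _ _ u_s) m_u.
  move: ip m_u; rewrite -val_eqE /= -(subnKC le_pi) u_s mult_at_cat m_s.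
  case: (i - size p)%N => [|j]; first by rewrite addn0 eqxx.
  move=> _ /eqP; rewrite eqseq_cat // => /andP[_ /eqP[/eqP]].
  by rewrite -[X in _ == X]cats0 eqseq_cat // eqxx (negPf v'_n0).
have [->|/x_v /startsP[s' u'_s]] := eqVneq (x u') 0; first by rewrite mul0r.
rewrite big1 ?mulr0 // => i _; case: eqP => [m_u|]; last by rewrite mulr0.
have le_pi := rigid_merge_ge p_rigid (level_v _ _ u'_s) m_u.
move: m_u; rewrite /= -(subnKC le_pi) u'_s mult_at_cat m_s.
move=> /eqP; rewrite eqseq_cat // => /andP[_ /eqP].
have vv' : v ++ v' <> v.
  by rewrite -{2}[v]cats0 => /eqP; rewrite eqseq_cat // eqxx (negPf v'_n0).
case: (i - size p)%N s' u'_s => [|j] [|v1 s'] u'_s [] //.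
move=> /eqP; rewrite eqseq_cat // eqxx => /eqP v1_v' s_s'.
by case/eqP: u'_u; apply/val_inj/val_inj; rewrite /= u'_s u_s v1_v' s_s'.
Qed.

(** Extends the coefficients by 0 to arbitrary lists of words, so that they can be read at a merged
    list that need not be a basis tensor. *)
Definition bar_coef k (f : bar k) u : K :=
  \sum_(v : bar_basis ws w k | tval v == u :> seq _) f v.

Lemma bar_coef_basis k (f : bar k) (u : bar_basis ws w k) : bar_coef f u = f u.
Proof.
rewrite /bar_coef (bigD1 u) //= big1 ?addr0 // => v /andP[/eqP v_u].
by case/eqP; apply/val_inj/val_inj.
Qed.

(** Acyclicity of the quotient of [level p b] by [level (rcons p v) d]. The position [d] need only
    have no zero before it, so the lemma also serves when no next zero exists, with [d] beyond the
    end of the word. *)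
Lemma level_retract p b d k (f : bar k) :
    let v := subword (size (flatten p)) b in
    (size (flatten p) < b)%N -> (b < size w)%N -> (b < d)%N ->
    flatten p = take (size (flatten p)) w -> rigid p b ->
    (forall c, (b < c < d)%N -> (c <= size w)%N ->
       ~~ is_zero ws (subword (size (flatten p)) c)) ->
    supported (level p b) f ->
    supported (level (rcons p v) d) (D k f) ->
  exists2 g : bar k.+1, supported (level p b) g
    & supported (level (rcons p v) d) (f - D k.+1 g).
Proof.
move=> v lt_pb lt_bw lt_bd p_w p_rigid v_d f_p Df_p.
have pv : (size (flatten p) + size v)%N = b.
  by apply: size_subword; rewrite (ltnW lt_pb) (ltnW lt_bw).
have flat_pv : size (flatten (rcons p v)) = b by rewrite flatten_rcons size_cat.
have lt_pvd : (size (flatten (rcons p v)) < d)%N by rewrite flat_pv.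
have level_starts u : starts p v u -> level p b u.
  by case/startsP=> s ->; apply/levelP => //; exists v, s; rewrite pv.
have sub_starts u : level (rcons p v) d u -> starts p v u.
  case/(levelP _ lt_pvd) => v1 [s [-> _]].
  by apply/startsP; exists (v1 :: s); rewrite cat_rcons.
(* Subtracting [D g] from [f] kills its coefficient at each matched tensor   *)
(* p, v ++ v', s; by [bar_diff_merge], the one at p, v, v', s is then, up to *)
(* sign, a coefficient of [D f], which vanishes by hypothesis.               *)
pose g : bar k.+1 := [ffun u : bar_basis ws w k.+1 => if starts p v u then
  (-1) ^+ size p * bar_coef f (mult_at (size p) u) else 0 : K^o].
have g_starts : supported (starts p v) g.
  by move=> u; rewrite ffunE; case: ifP => // _; rewrite eqxx.
have g_p : supported (level p b) g by move=> u /g_starts/level_starts.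
have h_p : supported (level p b) (f - D k.+1 g).
  move=> u; apply: contraR => u_p; rewrite !ffunE.
  rewrite (contraNeq (@f_p u)) //.
  by rewrite (contraNeq (@supported_diff _ _ _ _ lt_pb p_rigid g_p u)) ?subr0.
exists g => //.
have h_starts : supported (starts p v) (f - D k.+1 g).
  move=> u hu; have /(levelP _ lt_pb)[v1 [s [u_s le_bv1]]] := h_p _ hu.
  have u_w := bar_basisP u; rewrite u_s in u_w.
  have [|v' v1_v] := level_block _ p_w u_w le_bv1.
    by rewrite (ltnW lt_pb) (ltnW lt_bw).
  have [v'0|v'_n0] := eqVneq v' [::].
    by apply/startsP; exists s; rewrite u_s v1_v v'0 cats0.
  case/negP: hu; rewrite !ffunE subr_eq0.
  have /and3P[p_basis v1_basis s_basis] :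
    [&& all (basis_word ws) p, basis_word ws v1 & all (basis_word ws) s].
    by move: u_w; rewrite /bar_word all_cat => /andP[].
  have v_n0 : v != [::].
    by rewrite -size_eq0 -(eqn_add2l (size (flatten p))) pv addn0 gtn_eqF.
  have [u' u'_s] : exists u' : bar_basis ws w k.+1, tval u' = p ++ v :: v' :: s.
    apply: bar_word_basis; last first.
      by rewrite -(size_tuple u) u_s !size_cat /= addnS.
    move: u_w; rewrite /bar_word v1_v !flatten_cat /= -catA => /andP[-> _].
    rewrite all_cat /= p_basis s_basis andbT.
    rewrite v1_v in v1_basis; rewrite (basis_word_catl v_n0 v1_basis).
    exact: basis_word_catr v1_basis.
  rewrite v1_v in u_s.
  rewrite (bar_diff_merge (b := b) _ p_rigid g_starts u'_s u_s);
    last by rewrite lt_pb pv leqnn.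
  have u'_v : starts p v u' by rewrite u'_s; apply/startsP; eexists.
  rewrite ffunE u'_v mulrA -expr2 sqrr_sign mul1r u'_s.
  by rewrite -[in mult_at _](addn0 (size p)) mult_at_cat /= -u_s bar_coef_basis.
move=> u; apply: contraR => u_pv; apply/contraT => hu.
have /startsP[s u_s] := h_starts _ hu.
have u_w := bar_basisP u; rewrite u_s in u_w.
have [_ w_v p_basis v_basis s_basis] := bar_word_cat p_w u_w.
case: s => [|v1 s] in u_s u_w w_v s_basis.
  (* Since b < n, the block [v] cannot be the last one. *)
  by move: lt_bw; rewrite -pv -subn_gt0 subnDA -size_drop w_v cats0 subnn.
have lt_d : (b + size v1 < d)%N.
  rewrite ltnNge; apply: contra u_pv => le_d; rewrite u_s -cat_rcons.
  by apply/levelP => //; exists v1, s; rewrite flat_pv.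
(* The next block ends before [d], so [v ++ v1] is nonzero and the merged tensor [m] is a basis
   tensor. *)
have /= /andP[/andP[v1_n0 _] s_basis'] := s_basis.
have [m m_s] : exists m : bar_basis ws w k.-1, tval m = p ++ (v ++ v1) :: s.
  apply: bar_word_basis; last first.
    by rewrite -(size_tuple u) u_s !size_cat /= !addnS.
  move: u_w; rewrite /bar_word !flatten_cat /= -catA => /andP[-> _].
  rewrite all_cat /= p_basis s_basis' andbT /= /basis_word.
  have -> : v ++ v1 != [::] by case: (v) v_basis.
  rewrite (@take_drop_catl _ w (v ++ v1) (flatten s) (size (flatten p)));
    last by rewrite -catA.
  rewrite size_cat addnA pv v_d //.
    by rewrite lt_d andbT -[X in (X < _)%N]addn0 ltn_add2l lt0n size_eq0.
  rewrite -pv -addnA -size_cat -leq_subRL;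
    last by rewrite p_w size_take_min geq_minr.
  by rewrite -size_drop w_v /= catA [X in (_ <= X)%N]size_cat leq_addr.
have := bar_diff_merge (b := b) _ p_rigid h_starts u_s m_s.
rewrite lt_pb pv leqnn => /(_ isT) /eqP.
rewrite linearB /= bar_diffK subr0.
have /(contraNeq (@Df_p m)) -> : ~~ level (rcons p v) d m.
  apply/negP => /sub_starts/startsP[s']; rewrite m_s => /eqP.
  rewrite eqseq_cat // => /andP[_ /eqP[/eqP]].
  by rewrite -[X in _ == X]cats0 eqseq_cat // eqxx (negPf v1_n0).
by rewrite eq_sym mulf_eq0 signr_eq0 (negPf hu).
Qed.

(** * Comparing the homology of a complex and a subcomplex *)

Lemma supported0 P k : supported P (0 : bar k).
Proof. by move=> u; rewrite ffunE eqxx. Qed.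

Lemma supportedD P k (f g : bar k) :
  supported P f -> supported P g -> supported P (f + g).
Proof.
move=> f_P g_P u; apply: contraR => u_P.
by rewrite ffunE (contraNeq (@f_P u)) // (contraNeq (@g_P u)) // addr0.
Qed.

Lemma supported_sub (P Q : pred (seq (seq X))) k (f : bar k) :
  (forall u, Q u -> P u) -> supported Q f -> supported P f.
Proof. by move=> QP f_Q u /f_Q/QP. Qed.

Lemma supported_eq0 (P : pred (seq (seq X))) k (f : bar k) :
    (forall u, bar_word u -> size u = k -> ~~ P u) -> supported P f ->
  f = 0.
Proof.
move=> P0 f_P; apply/ffunP => u; rewrite ffunE; apply: contraNeq (@f_P u) _.
by rewrite P0 ?bar_basisP ?size_tuple.
Qed.

Definition acyclic_on (P : pred (seq (seq X))) := forall k (f : bar k),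
  supported P f -> D k f = 0 ->
  exists2 g : bar k.+1, supported P g & f = D k.+1 g.

Definition line_homology_on (P : pred (seq (seq X))) k0 :=
  exists2 e : bar k0,
    [/\ supported P e, D k0 e = 0
      & forall g : bar k0.+1, supported P g -> e <> D k0.+1 g]
    & [/\ forall k (f : bar k), k != k0 -> supported P f -> D k f = 0 ->
            exists2 g : bar k.+1, supported P g & f = D k.+1 g
        & forall f : bar k0, supported P f -> D k0 f = 0 ->
            exists c : K, exists2 g : bar k0.+1, supported P g
              & f = c *: e + D k0.+1 g].

Section Retract.
Variables P Q : pred (seq (seq X)).
Hypothesis sub_QP : forall u, Q u -> P u.
(* Equivalently, the quotient of the chains on P by those on Q is acyclic. *)
Hypothesis retract : forall k (f : bar k),
  supported P f -> supported Q (D k f) ->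
  exists2 g : bar k.+1, supported P g & supported Q (f - D k.+1 g).

Lemma cycle_retract k (f : bar k) : supported P f -> D k f = 0 ->
  exists2 g : bar k.+1, supported P g
    & supported Q (f - D k.+1 g) /\ D k (f - D k.+1 g) = 0.
Proof.
move=> f_P Df; have [|g g_P fg_Q] := retract f_P.
  by rewrite Df; apply: supported0.
by exists g => //; split=> //; rewrite linearB /= Df bar_diffK subr0.
Qed.

Lemma acyclic_retract : acyclic_on Q -> acyclic_on P.
Proof.
move=> Q0 k f f_P /(cycle_retract f_P)[g g_P [fg_Q /(Q0 _ _ fg_Q)[g' g'_Q fg]]].
exists (g' + g); last by rewrite linearD /= -fg subrK.
by apply: supportedD => //; apply: supported_sub g'_Q.
Qed.

(** The same generator works in the larger complex: were it a boundary there, its primitive would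
    have boundary in the subcomplex, so it could be moved into the subcomplex by a boundary, leaving
    its differential unchanged. *)
Lemma line_homology_retract k0 : line_homology_on Q k0 -> line_homology_on P k0.
Proof.
case=> e [e_Q De e_neq] [Q0 Q1]; exists e; split=> //.
- exact: supported_sub e_Q.
- move=> g g_P e_g; have [|g' g'_P gg'_Q] := retract g_P; first by rewrite -e_g.
  by apply: e_neq gg'_Q _; rewrite linearB /= -e_g bar_diffK subr0.
- move=> k f k_neq f_P.
  move=> /(cycle_retract f_P)[g g_P [fg_Q /(Q0 _ _ k_neq fg_Q)[g' g'_Q fg]]].
  exists (g' + g); last by rewrite linearD /= -fg subrK.
  by apply: supportedD => //; apply: supported_sub g'_Q.
move=> f f_P /(cycle_retract f_P)[g g_P [fg_Q /(Q1 _ fg_Q)[c [g' g'_Q fg]]]].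
exists c, (g' + g); last by rewrite linearD /= addrA -fg subrK.
by apply: supportedD => //; apply: supported_sub g'_Q.
Qed.

End Retract.

Lemma acyclic_empty (P : pred (seq (seq X))) :
  (forall u, bar_word u -> ~~ P u) -> acyclic_on P.
Proof.
move=> P0 k f f_P _; exists 0; first exact: supported0.
by rewrite linear0; apply: supported_eq0 f_P => u u_w _; apply: P0.
Qed.

(** * Induction along the Dyck path *)

(** A block reaching the end of the word leaves [u0] as the only candidate; the alternative is
    whether its factors are all nonzero. *)
Lemma level_last p : (size (flatten p) < size w)%N ->
    flatten p = take (size (flatten p)) w -> rigid p (size w) ->
  acyclic_on (level p (size w)) \/
  line_homology_on (level p (size w)) (size p).+1.
Proof.
move=> lt_pw p_w p_rigid; pose u0 := rcons p (drop (size (flatten p)) w).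
have only_u0 u : bar_word u -> level p (size w) u -> u = u0.
  move=> u_w /(levelP _ lt_pw)[v [s [u_s le_wv]]]; rewrite u_s in u_w *.
  have [_ w_v _ _ s_basis] := bar_word_cat p_w u_w.
  rewrite /u0 -cat_rcons w_v.
  have : size (flatten s) = 0.
    apply/eqP; rewrite -leqn0 -(leq_add2l (size v)) -size_cat -w_v addn0.
    by rewrite size_drop leq_subLR.
  case: s s_basis {u_s u_w w_v} => [|v1 s] /=; first by rewrite cats0 cats0.
  by case: v1.
have [u0_w|u0_w] := boolP (bar_word u0); last first.
  left; apply: acyclic_empty => u u_w; apply: contra u0_w => u_p.
  by rewrite -(only_u0 u).
have size_u0 : size u0 = (size p).+1 by rewrite size_rcons.
right; have [e e_u0] := bar_word_basis u0_w size_u0.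
have e_p : level p (size w) e.
  apply/levelP => //; exists (drop (size (flatten p)) w), [::].
  by rewrite e_u0 /u0 -cats1 size_drop (subnKC (ltnW lt_pw)).
have zero_neq k (f : bar k) :
    k != (size p).+1 -> supported (level p (size w)) f -> f = 0.
  move=> k_neq; apply: supported_eq0 => u u_w u_k; apply: contra k_neq => u_p.
  by rewrite -u_k (only_u0 u) ?size_u0.
pose delta : bar (size p).+1 := [ffun u => (u == e)%:R : K^o].
have delta_p : supported (level p (size w)) delta.
  by move=> u; rewrite ffunE; case: (u =P e) => [->|]; rewrite ?eqxx.
exists delta; split=> //.
- by apply: zero_neq; [rewrite neq_ltn ltnSn | apply: supported_diff].
- move=> g /zero_neq->; last by rewrite neq_ltn ltnSn orbT.
  by rewrite linear0 => /ffunP/(_ e)/eqP; rewrite !ffunE eqxx oner_eq0.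
- move=> k f k_neq f_p _; exists 0; first exact: supported0.
  by rewrite linear0; apply: zero_neq f_p.
move=> f f_p _; exists (f e), 0; first exact: supported0.
rewrite linear0 addr0; apply/ffunP => u; rewrite !ffunE.
have [->|u_e] := eqVneq u e; first by rewrite [RHS]mulr1.
rewrite [RHS]mulr0; apply: contraNeq u_e => /f_p u_p.
apply/eqP/val_inj/val_inj; rewrite /= e_u0.
by apply: only_u0 => //; apply: bar_basisP.
Qed.

(** The only new merge joins the appended factor to a block reaching [d], and the result contains
    the zero word ending at [d]. The other merges are excluded by the rigidity of [p]. *)
Lemma rigid_rcons p b d : (size (flatten p) < b < d)%N -> (b <= size w)%N ->
    flatten p = take (size (flatten p)) w -> rigid p b ->
    is_zero ws (subword (size (flatten p)) d) ->
  rigid (rcons p (subword (size (flatten p)) b)) d.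
Proof.
move=> /andP[lt_pb lt_bd] le_bw p_w p_rigid d_zero u i.
set v := subword _ b.
have pv : (size (flatten p) + size v)%N = b.
  by apply: size_subword; rewrite (ltnW lt_pb) le_bw.
have flat_pv : size (flatten (rcons p v)) = b by rewrite flatten_rcons size_cat.
have lt_pvd : (size (flatten (rcons p v)) < d)%N by rewrite flat_pv.
case/(levelP _ lt_pvd) => v1 [s [-> le_d]]; rewrite cat_rcons => u_w.
rewrite size_rcons ltnS leq_eqVlt => /predU1P[->|lt_ip]; last first.
  by apply: p_rigid => //; apply/levelP => //; exists v; eexists; rewrite pv.
rewrite -[size p]addn0 mult_at_cat /= all_cat /=.
suff /negPf-> : ~~ basis_word ws (v ++ v1) by rewrite andbF.
rewrite negb_and; apply/orP; right.
rewrite (@take_drop_catl _ w (v ++ v1) (flatten s) (size (flatten p))).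
  rewrite negbK; apply: is_zero_subword _ d_zero.
  by rewrite size_cat addnA pv -flat_pv.
by rewrite -u_w flatten_cat drop_size_cat //= catA.
Qed.

(** Induction on the fuel [m]: [b] strictly increases at each recursive call, so the bound on
    [m + b] prevents exhaustion. The pair [size (flatten p)], [b] is the state of [dyck_from]. *)
Lemma dyck_homology m p b :
    (size (flatten p) < b <= size w)%N -> (size w < m + b)%N ->
    flatten p = take (size (flatten p)) w -> rigid p b ->
  acyclic_on (level p b) \/
  let s := dyck_from ws w m (size (flatten p)) b in
  [/\ path ltn b s, (b + size s <= size w)%N
    & line_homology_on (level p b) (size p + size s).+1].
Proof.
elim: m p b => [|m IHm] p b /andP[lt_pb le_bw] lt_w p_w p_rigid.
  by move: lt_w; rewrite add0n ltnNge le_bw.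
have pv := size_subword (introT andP (conj (ltnW lt_pb) le_bw)).
set v := subword _ b in pv.
have flat_pv : size (flatten (rcons p v)) = b by rewrite flatten_rcons size_cat.
have pv_w : flatten (rcons p v) = take b w.
  rewrite flatten_rcons p_w -[RHS](cat_take_drop (size (flatten p))).
  by rewrite take_takel // ltnW.
have sub_level d u : (b < d)%N -> level (rcons p v) d u -> level p b u.
  move=> lt_bd /levelP; rewrite flat_pv => /(_ lt_bd)[v1 [s [-> _]]].
  by apply/levelP => //; exists v, (v1 :: s); rewrite cat_rcons pv.
rewrite /=; case: next_zeroP => [d /andP[lt_pd le_dw] d_zero d_min | no_zero].
  have [le_db|lt_bd] := leqP d b.
    left; apply: acyclic_empty => u u_w; apply/negP.
    case/(levelP _ lt_pb)=> v1 [s [u_s le_b]]; rewrite u_s in u_w.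
    have [v1_w _ _ /andP[_ v1_nz] _] := bar_word_cat p_w u_w.
    case/negP: v1_nz; rewrite v1_w; apply: is_zero_subword _ d_zero.
    exact: leq_trans le_b.
  have retr k (f : bar k) : supported (level p b) f ->
      supported (level (rcons p v) d) (D k f) ->
      exists2 g : bar k.+1, supported (level p b) g
        & supported (level (rcons p v) d) (f - D k.+1 g).
    apply: level_retract => //; first exact: leq_trans le_dw.
    by move=> c /andP[lt_bc lt_cd] _; rewrite d_min // (ltn_trans lt_pb).
  have := IHm (rcons p v) d; rewrite flat_pv lt_bd le_dw => -[] //.
  - by apply: (leq_trans lt_w); rewrite addSnnS leq_add2l.
  - by apply: rigid_rcons => //; rewrite lt_pb.
  - by move/(acyclic_retract (sub_level d ^~ lt_bd) retr); left.
  rewrite size_rcons /= => -[d_s le_s Hs]; right; split.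
  - by rewrite lt_bd.
  - by apply: leq_trans le_s; rewrite addnS -addSn leq_add2r.
  rewrite addnS -addSn; apply: line_homology_retract retr _ Hs => u.
  exact: sub_level.
rewrite /= !addn0.
have [b_w|lt_bw] := eqVneq b (size w).
  by rewrite b_w in p_rigid lt_pb *; case: (level_last lt_pb p_w p_rigid) => ?;
    [left | right].
have {}lt_bw : (b < size w)%N by rewrite ltn_neqAle lt_bw.
(* With [d] set to n + 1 the smaller level is empty, as no block ends beyond n. *)
left; apply: (@acyclic_retract _ (level (rcons p v) (size w).+1)).
- by move=> u; apply: sub_level.
- move=> k f; apply: level_retract => //.
  by move=> c /andP[lt_bc _] le_cw; rewrite no_zero // (ltn_trans lt_pb).
apply: acyclic_empty => u /andP[/eqP u_w _]; apply/negP; case/andP=> _.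
rewrite leqNgt ltnS -u_w.
rewrite -[X in (_ <= size (flatten X))%N](cat_take_drop (size (rcons p v)).+1).
by rewrite flatten_cat size_cat leq_addr.
Qed.

End DyckFiltration.

(** * Homology of the whole complex *)

Theorem theorem3p1 (K : fieldType) (X : choiceType)
    (t : nat) (ws : t.-tuple (seq X))
    (ws_neq0 : forall i : 'I_t, tnth ws i != [::])
    (ws_factor : forall i j : 'I_t, i != j -> ~~ infix (tnth ws i) (tnth ws j))
    (ws_letter : forall (i : 'I_t) (x : X), tnth ws i != [:: x])
    (w : seq X) (w_neq0 : w != [::])
    (w_nexact : ~ bar_exact K ws w) :
  let n := size w in
  let r := dyck_length ws w in
  \dim (bar_homology K ws w (n - r)) = 1%N /\
  (forall i : nat, (1 <= i <= n)%N -> i != (n - r)%N ->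
     bar_homology K ws w i = 0%VS).
Proof.
move=> n r.
have n_gt0 : (0 < n)%N by rewrite lt0n size_eq0.
(* The pair (0, 1) imposes no condition, since the first block is nonempty. *)
have all_level k (f : bar K ws w k) : supported (level [::] 1) f.
  move=> u _; rewrite /level /= take0 eqxx.
  have /andP[/eqP u_w /allP u_basis] := bar_basisP u.
  case: (tval u) u_w u_basis => [|v s] u_w u_basis.
    by rewrite -u_w in w_neq0.
  rewrite /= take0 cats0.
  by case: v u_basis {u_w} => // /(_ [::] (mem_head _ _)).
have exact_of k : (forall f : bar K ws w k, supported (level [::] 1) f ->
      bar_diff K ws w k f = 0 ->
      exists2 g : bar K ws w k.+1, supported (level [::] 1) g
        & f = bar_diff K ws w k.+1 g) ->
    bar_ker K ws w k = bar_im K ws w k.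
  move=> Hk; apply/eqP; rewrite eqEsubv bar_im_sub_ker andbT.
  apply/subvP => f; rewrite memv_ker => /eqP/(Hk _ (all_level _ _))[g _ ->].
  exact: memv_img (memvf _).
have [||||ex|] := @dyck_homology X t ws w K (2 * n) [::] 1 => //.
- by rewrite addn1 ltnS mul2n -addnn leq_addr.
- by rewrite /= take0.
- by case: w_nexact => k _; apply: exact_of; apply: ex.
rewrite /= add0n -/(dyck_path ws w) => -[path_s le_s [e [_ De e_neq] [H0 H1]]].
(* A strictly increasing path has no repetitions, so counting its distinct entries counts all of
   them. *)
have r_s : size (dyck_path ws w) = r.
  rewrite /r /dyck_length undup_id //; apply: (sorted_uniq ltn_trans ltnn).
  exact: path_sorted path_s.
rewrite r_s in e De e_neq H0 H1.
have le_rn : (r < n)%N by rewrite -r_s -add1n.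
split=> [|i /andP[i_gt0 le_in] i_neq]; last first.
  apply/eqP; rewrite diffv_eq0 exact_of // => f; apply: H0.
  by apply: contra i_neq => /eqP[<-]; rewrite subKn.
rewrite /bar_homology -/n subKn; last exact: ltnW.
have e_im : e \notin bar_im K ws w r.+1.
  by apply/negP => /memv_imgP[g _ /e_neq]; apply.
have ker_im : bar_ker K ws w r.+1 = (<[e]> + bar_im K ws w r.+1)%VS.
  apply/eqP; rewrite eqEsubv subv_add bar_im_sub_ker -memvE memv_ker De eqxx.
  rewrite !andbT.
  apply/subvP => f; rewrite memv_ker => /eqP/(H1 _ (all_level _ _))[c [g _ ->]].
  by rewrite memv_add ?memvZ ?memv_line ?memv_img ?memvf.
(* The complement has dimension dim ker - dim im, and the kernel is the direct sum of the line of
   [e] and the image. *)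
have := dimv_cap_compl (bar_ker K ws w r.+1) (bar_im K ws w r.+1).
rewrite (capv_idPr (bar_im_sub_ker _ _ _ _)) [X in _ = \dim X]ker_im.
rewrite dimv_disjoint_sum => [/eqP|].
  rewrite dim_vline addnC eqn_add2r => /eqP->.
  by case: eqVneq e_im => // ->; rewrite mem0v.
apply/eqP; rewrite -subv0; apply/subvP => x; rewrite memv_cap.
case/andP=> /vlineP[c ->]; rewrite rpredZeq (negPf e_im) orbF => /eqP->.
by rewrite scale0r mem0v.
Qed.
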